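(* Let $N\ge 1$, $0\le r\le N$, and $\lambda=(\lambda_1,\dots,\lambda_N)$ with $\lambda_1\ge\lambda_2\ge\dots\ge\lambda_N\ge 0$. Assume $g\in C^{2,3,mix}$, and let $u$ be the solution of $$\frac{\partial u}{\partial t}=\sum_{k=1}^N\lambda_k\frac{\partial^2u}{\partial z_k^2}\quad (z\in\mathbb{R}^N,\ t\in(0,T)),\qquad u(z,0)=g(z).$$ Let $$u_{r,2}=\Big(1+\tfrac{(N-r)(N-r-3)}{2}\Big)u^{\{1,\dots,r\}}+(2-(N-r))\sum_{k=r+1}^N u^{\{1,\dots,r,k\}}+\sum_{r<k<l\le N}u^{\{1,\dots,r,k,l\}}$$ be the second order expansion and $\hat u_{r,2}$ its expansion error, i.e. the difference between $u_{r,2}$ and $u$. Then for all $t\in(0,T)$ $$\left\|\hat u_{r,2}(\cdot,t)\right\|_\infty\le t^3\sum_{r<i<j<k\le N}\lambda_i\lambda_j\lambda_k\left\|\frac{\partial^6 g}{\partial z_i^2\partial z_j^2\partial z_k^2}\right\|_\infty .$$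
   Context: $C^b$ is the set of bounded continuous functions $\mathbb{R}^N\to\mathbb{R}$. $C^{j,k,mix}=\{g\in C^b:\ \partial_{i_1}^j\cdots\partial_{i_k}^j g\in C^b\ \text{for all } 1\le i_1<\dots<i_k\le N\}$; thus $g\in C^{2,3,mix}$ means $g\in C^b$ and $\partial_{i_1}^2\partial_{i_2}^2\partial_{i_3}^2 g\in C^b$ for all $1\le i_1<i_2<i_3\le N$. For an index set $\nu\subseteq\{1,\dots,N\}$, $u^\nu$ denotes the solution of $\partial_t u^\nu=\sum_{k\in\nu}\lambda_k\partial_{z_k}^2u^\nu$, $u^\nu(\cdot,0)=g$, on $\mathbb{R}^N\times(0,T)$; in particular $u=u^{\{1,\dots,N\}}$. Solutions are the ones given by the Green's function representation $$u^\nu(z,t)=\int_{\mathbb{R}^N}\Phi^\nu(y,t)\,g(z-y)\,dy,\qquad \Phi^\nu(y,t)=\prod_{k\in\nu}\frac{\exp(-y_k^2/(4\lambda_kt))}{\sqrt{4\pi\lambda_kt}}\prod_{k\notin\nu}\delta(y_k),$$ where $\delta$ is the Dirac delta (no integration in that coordinate); a factor with $k\in\nu$, $\lambda_k=0$ is also read as $\delta(y_k)$. For $r=0$, $\{1,\dots,r\}=\emptyset$. $\|\cdot\|_\infty$ is the supremum norm over $\mathbb{R}^N$. *)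

(* Defs.v *)
From HB Require Import structures.
From mathcomp Require Export all_boot all_order all_algebra.
From mathcomp Require Export all_classical all_reals all_analysis.
Set Implicit Arguments.
Unset Strict Implicit.
Unset Printing Implicit Defensive.
Import Order.TTheory GRing.Theory Num.Theory.
Export numFieldNormedType.Exports.

Local Open Scope classical_set_scope.
Local Open Scope ring_scope.

(* The product on T^(n+1) of a measure on T and a measure on T^n, transported
   from the library's product measure on T * T^n. *)
Section cons_measure.
Context (R : realType) (d : measure_display) (T : measurableType d) (n : nat).

Definition cons_tuple (p : T * n.-tuple T) : n.+1.-tuple T :=
  [tuple of p.1 :: p.2].

Lemma measurable_cons_tuple : measurable_fun [set: T * n.-tuple T] cons_tuple.
Proof. exact: measurable_cons. Qed.

Variable m1 : {sigma_finite_measure set T -> \bar R}.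
Variable m2 : {sigma_finite_measure set (n.-tuple T) -> \bar R}.

Definition cons_measure : set (n.+1.-tuple T) -> \bar R :=
  pushforward (m1 \x m2)%E cons_tuple.

Let cons_measure0 : cons_measure set0 = 0%E.
Proof. by rewrite /cons_measure /pushforward preimage_set0 measure0. Qed.

Let cons_measure_ge0 A : (0 <= cons_measure A)%E.
Proof. by rewrite /cons_measure /pushforward. Qed.

Let cons_measure_sigma_additive : semi_sigma_additive cons_measure.
Proof.
move=> F mF tF mUF; rewrite /cons_measure /pushforward preimage_bigcup.
have mp i : measurable (cons_tuple @^-1` F i).
  rewrite -[X in measurable X]setTI.
  by apply: (measurable_cons_tuple measurableT); exact: mF.
apply: measure_semi_sigma_additive => //.
- apply/trivIsetP => /= i j _ _ ij; rewrite -preimage_setI.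
  by move/trivIsetP : tF => /(_ _ _ _ _ ij) ->//; rewrite preimage_set0.
- exact: bigcupT_measurable.
Qed.

HB.instance Definition _ := isMeasure.Build _ _ _
  cons_measure cons_measure0 cons_measure_ge0 cons_measure_sigma_additive.

Let cons_measure_sigma_finite : sigma_finite setT cons_measure.
Proof.
have /sigma_finiteP[F [TF ndF Foo]] := sigma_finiteT m1.
have /sigma_finiteP[G [TG ndG Goo]] := sigma_finiteT m2.
pose un (v : n.+1.-tuple T) : T * n.-tuple T :=
  (thead v, [tuple of behead v]).
have unK p : un (cons_tuple p) = p.
  by case: p => x v; rewrite /un; congr pair; last exact: val_inj.
have mun : measurable_fun [set: n.+1.-tuple T] un.
  apply: measurable_fun_pair; last exact: measurable_behead.
  exact: measurable_tnth.
exists (fun i => un @^-1` (F i `*` G i)).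
  apply/seteqP; split=> // v _.
  have [i _ Fi] : (\bigcup_i F i) (un v).1 by rewrite -TF.
  have [j _ Gj] : (\bigcup_i G i) (un v).2 by rewrite -TG.
  exists (maxn i j) => //; split.
    by move: Fi; exact/subsetPset/ndF/leq_maxl.
  by move: Gj; exact/subsetPset/ndG/leq_maxr.
move=> i; have [mF Fioo] := Foo i; have [mG Gioo] := Goo i.
have mFG : measurable (F i `*` G i) by exact: measurableX.
split; first by rewrite -[X in measurable X]setTI; exact: mun.
rewrite /cons_measure /pushforward -comp_preimage.
rewrite (_ : un \o cons_tuple = id); last by apply/funext => p; exact: unK.
by rewrite preimage_id product_measure1E// lte_mul_pinfty// ge0_fin_numE.
Qed.

HB.instance Definition _ := Measure_isSigmaFinite.Build _ _ _
  cons_measure cons_measure_sigma_finite.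

End cons_measure.

Fixpoint prod_measure (R : realType) (d : measure_display)
    (T : measurableType d) (n : nat) :
    ('I_n -> {sigma_finite_measure set T -> \bar R}) ->
    {sigma_finite_measure set (n.-tuple T) -> \bar R} :=
  match n with
  | 0 => fun _ => \d_[tuple]
  | n'.+1 => fun m =>
      cons_measure (m ord0) (prod_measure (fun i => m (lift ord0 i)))
  end.

Section definitions.
Context (R : realType) (N : nat).
Local Notation mR := (measurableTypeR R).
Local Notation RN := 'rV[R]_N.
Implicit Types (f g : RN -> R) (s : seq 'I_N) (lambda : 'I_N -> R)
  (nu : {set 'I_N}) (t : R) (z : RN) (r : nat).

Definition bounded_continuous f : Prop := continuous f /\ bounded_fun f.

(* Valued in the extended reals, so that it is +oo for unbounded f. *)
Definition supnorm f : \bar R := ereal_sup (range (fun z => (`|f z|)%:E)).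

Definition pderiv (i : 'I_N) f : RN -> R := 'D_(delta_mx 0 i : RN) f.

(* pderivs [:: i1; ...; ik] f is d_{i1} (... (d_{ik} f)). *)
Definition pderivs s f : RN -> R := foldr pderiv f s.

(* 'D_v is a total function; pderivable s f states that each of the successive
   partial derivatives used by pderivs s f exists everywhere. *)
Fixpoint pderivable s f : Prop :=
  if s is i :: s' then
    pderivable s' f /\
    forall z, derivable (pderivs s' f) z (delta_mx 0 i : RN)
  else True.

Definition repeat_dirs (j : nat) s : seq 'I_N := flatten [seq nseq j i | i <- s].

Definition C_mix (j k : nat) g : Prop :=
  bounded_continuous g /\
  forall s, size s = k -> sorted (fun a b : 'I_N => (a < b)%N) s ->
    pderivable (repeat_dirs j s) g /\
    bounded_continuous (pderivs (repeat_dirs j s) g).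

Definition heat_kernel (c x : R) : R :=
  expR (- x ^+ 2 / (4 * c)) / Num.sqrt (4 * pi * c).

(* The coordinates of nu whose factor in the Green's function is a genuine
   Gaussian (for t > 0); all other factors are Dirac deltas. *)
Definition gauss_dirs lambda nu : {set 'I_N} := [set k in nu | lambda k != 0].

(* "dy" together with the delta factors: Lebesgue measure in the Gaussian
   coordinates, the Dirac measure at 0 in the others. *)
Definition green_measure lambda nu :
    {sigma_finite_measure set (N.-tuple mR) -> \bar R} :=
  prod_measure (fun k => if k \in gauss_dirs lambda nu
    then [the {sigma_finite_measure set mR -> \bar R} of lebesgue_measure]
    else [the {sigma_finite_measure set mR -> \bar R} of \d_(0 : mR)]).

Definition heat_sol lambda g nu z t : R :=
  \int[green_measure lambda nu]_y
    ((\prod_(k in gauss_dirs lambda nu) heat_kernel (lambda k * t) (tnth y k))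
     * g (z - \row_k tnth y k)).

(* The indices 1, ..., r are the ordinals below r. *)
Definition first_dirs r : {set 'I_N} := [set i : 'I_N | (i < r)%N].

Definition second_order_expansion r lambda g z t : R :=
  let m : R := N%:R - r%:R in
  (1 + m * (m - 3) / 2) * heat_sol lambda g (first_dirs r) z t
  + (2 - m) * \sum_(k < N | (r <= k)%N)
      heat_sol lambda g (k |: first_dirs r) z t
  + \sum_(k < N | (r <= k)%N) \sum_(l < N | (k < l)%N)
      heat_sol lambda g (k |: (l |: first_dirs r)) z t.

Definition expansion_error r lambda g z t : R :=
  second_order_expansion r lambda g z t - heat_sol lambda g [set: 'I_N] z t.

End definitions.

(* Main.v *)
Require Import Defs.
From mathcomp Require Import measurable_realfun.
From mathcomp Require Import zify ring lra.
Set Implicit Arguments.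
Unset Strict Implicit.
Unset Printing Implicit Defensive.
Import Order.TTheory GRing.Theory Num.Theory.
Local Open Scope classical_set_scope.
Local Open Scope ring_scope.

(** Freezing every coordinate outside [nu] commutes with averaging: with [Y] the
    vector of independent centred Gaussian variables of variances
    [2 * lambda k * t] (a variable of variance zero being the constant [0]), the
    solution [u^nu] at [z] is the mean of [g (z - Y_nu)], where [Y_nu] keeps the
    coordinates of [Y] in [nu] and replaces the others by [0]
    ([heat_sol_mean]). All the [u^nu] are thus means over one and the same
    probability space.

    The first ingredient is combinatorial and holds for an arbitrary function
    [h] of the index set. Let [D_i h (A) = h (A u {i}) - h (A)]. The value
    [h ({1, ..., N})] is the sum of all iterated differences [D_S h] at
    [{1, ..., r}], with [S] a set of indices above [r]; the second order
    expansion keeps the [S] with at most two elements. Grouping the remaining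
    ones by their three largest elements [i < j < k] gives
    [- sum_(r < i < j < k) D_i D_j D_k h ({1, ..., i - 1})] for the expansion
    minus [h ({1, ..., N})] ([expansion2E]).

    It remains to bound each [D_i D_j D_k u^A] by
    [t^3 * lambda i * lambda j * lambda k * M], with [M] a bound of the mixed
    sixth derivative ([adjoin_diff3_heat_sol_le]). The law of [Y] is invariant
    under changing the sign of one coordinate ([heat_mean_flip]), so that
    the mean can be symmetrised in the coordinates [i], [j], [k]; every
    one-sided difference then becomes half of a second symmetric difference
    [f (z + Y_i e_i) + f (z - Y_i e_i) - 2 f (z)]. Two applications of the mean
    value theorem in each of the three directions bound the triple second
    difference of [g] by [Y_i^2 * Y_j^2 * Y_k^2 * M] pointwise
    ([second_diff3_le]); this uses the existence of the intermediate
    derivatives, but neither their continuity nor their boundedness. Finally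
    the mean of
    [Y_i^2 * Y_j^2 * Y_k^2] is at most the product of the three variances, and
    the factors [2] cancel against the [1 / 2] of the symmetrisation. *)

(** * The remainder of the expansion as a sum of triple differences *)

Section Inclusion.
Variables (R : numFieldType) (N : nat).
Implicit Types (h : {set 'I_N} -> R) (B : {set 'I_N}).

(** The increment of a function of an index set when [i] is adjoined. *)
Definition adjoin_diff (i : 'I_N) h : {set 'I_N} -> R :=
  fun B => h (i |: B) - h B.

(** The second order expansion, for an arbitrary function of the index set in
    place of the solutions of the heat equation. *)
Definition expansion2 (r : nat) h : R :=
  let m : R := N%:R - r%:R in
  (1 + m * (m - 3) / 2) * h (first_dirs N r)
  + (2 - m) * \sum_(k < N | (r <= k)%N) h (k |: first_dirs N r)
  + \sum_(k < N | (r <= k)%N) \sum_(l < N | (k < l)%N)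
      h (k |: (l |: first_dirs N r)).

Lemma sum_ord_geS (i : 'I_N) (F : 'I_N -> R) :
  \sum_(k < N | (i <= k)%N) F k = F i + \sum_(k < N | (i < k)%N) F k.
Proof.
rewrite (bigD1 i) //=; congr (_ + _); apply: eq_bigl => k.
by rewrite ltn_neqAle andbC eq_sym.
Qed.

Lemma sum_ord_geN (r : nat) (F : 'I_N -> R) : (N <= r)%N ->
  \sum_(k < N | (r <= k)%N) F k = 0.
Proof.
move=> Nr; rewrite big_pred0// => k; apply/negbTE.
by rewrite -ltnNge (leq_trans (ltn_ord k)).
Qed.

Lemma first_dirsS (i : 'I_N) : first_dirs N i.+1 = i |: first_dirs N i.
Proof. by apply/setP => k; rewrite !inE ltnS leq_eqVlt. Qed.

Lemma first_dirs_all : first_dirs N N = [set: 'I_N]%SET.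
Proof. by apply/setP => k; rewrite !inE ltn_ord. Qed.

Lemma ord_down_ind (P : nat -> Prop) :
  P N -> (forall i : 'I_N, P i.+1 -> P i) -> forall r, (r <= N)%N -> P r.
Proof.
move=> PN PS r rN; rewrite -(subKn rN).
elim: (N - r)%N (leq_subr r N) => [|d IH] dN; first by rewrite subn0.
have dN' : (N - d.+1 < N)%N by lia.
apply: (PS (Ordinal dN')) => /=.
by rewrite -subSn// subSS; apply: IH; lia.
Qed.

Lemma sum_ord_ge1 (r : nat) : (r <= N)%N ->
  \sum_(k < N | (r <= k)%N) (1 : R) = N%:R - r%:R.
Proof.
move: r; apply: ord_down_ind => [|i IH]; first by rewrite sum_ord_geN// subrr.
by rewrite sum_ord_geS IH -natr1; ring.
Qed.

(** Each of the [N - r] indices from [r] on belongs to [N - r - 1] pairs. *)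
Lemma sum_pairs_add (F : 'I_N -> R) (r : nat) : (r <= N)%N ->
  \sum_(j < N | (r <= j)%N) \sum_(k < N | (j < k)%N) (F j + F k) =
  (N%:R - r%:R - 1) * \sum_(j < N | (r <= j)%N) F j.
Proof.
move: r; apply: ord_down_ind => [|i IH].
  by rewrite !sum_ord_geN// mulr0.
rewrite !sum_ord_geS IH big_split /=.
under eq_bigr do rewrite -(mulr1 (F i)).
rewrite -mulr_sumr sum_ord_ge1// -natr1; ring.
Qed.

(** Passing from [i] to [i.+1] adds to the expansion the triples with smallest
    element [i]. *)
Lemma expansion2_step h (i : 'I_N) :
  expansion2 i.+1 h - expansion2 i h =
  \sum_(j < N | (i < j)%N) \sum_(k < N | (j < k)%N)
     adjoin_diff i (adjoin_diff j (adjoin_diff k h)) (first_dirs N i).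
Proof.
pose B := first_dirs N i.
pose S (F : 'I_N -> 'I_N -> R) : R :=
  \sum_(j < N | (i < j)%N) \sum_(k < N | (j < k)%N) F j k.
have SD F G : S (fun j k => F j k + G j k) = S F + S G.
  by rewrite /S -big_split; apply: eq_bigr => j _; rewrite big_split.
have SN F : S (fun j k => - F j k) = - S F.
  by rewrite /S -sumrN; apply: eq_bigr => j _; rewrite sumrN.
have SA F : S (fun j k => F j + F k) =
    (N%:R - i.+1%:R - 1) * \sum_(j < N | (i < j)%N) F j.
  by rewrite /S (sum_pairs_add F (ltn_ord i)).
(* The constant terms are counted as the pair sum of the constant c. *)
have SK c : S (fun _ _ => c + c) =
    (N%:R - i.+1%:R - 1) * ((N%:R - i.+1%:R) * c).
  rewrite (SA (fun=> c)) -(sum_ord_ge1 (ltn_ord i)) mulr_suml.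
  by congr (_ * _); apply: eq_bigr => j _; rewrite mul1r.
transitivity (S (fun j k => h (j |: (k |: (i |: B)))
        + (- h (j |: (k |: B))
        + (- (h (j |: (i |: B)) + h (k |: (i |: B)))
        + ((h (j |: B) + h (k |: B))
        + ((h (i |: B) - h B) / 2 + (h (i |: B) - h B) / 2)))))); last first.
  apply: eq_bigr => j _; apply: eq_bigr => k _; rewrite /adjoin_diff -/B.
  rewrite (finset.setUCA [set k]%SET [set j]%SET (i |: B)).
  by rewrite (finset.setUCA [set k]%SET [set j]%SET B) -splitr; ring.
have /= SA1 := SA (fun j => h (j |: (i |: B))).
have /= SA0 := SA (fun j => h (j |: B)).
rewrite 4!SD !SN SA1 SA0 SK.
rewrite /expansion2 /= !sum_ord_geS first_dirsS -/B /S.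
have -> : \sum_(k < N | (i < k)%N) h (i |: (k |: B)) =
          \sum_(k < N | (i < k)%N) h (k |: (i |: B)).
  by apply: eq_bigr => k _; rewrite finset.setUCA.
by rewrite -natr1; field.
Qed.

Lemma expansion2E h r : (r <= N)%N ->
  expansion2 r h - h [set: 'I_N]%SET =
  - \sum_(i < N | (r <= i)%N) \sum_(j < N | (i < j)%N) \sum_(k < N | (j < k)%N)
      adjoin_diff i (adjoin_diff j (adjoin_diff k h)) (first_dirs N i).
Proof.
move: r; apply: ord_down_ind => [|i IH].
  by rewrite /expansion2 !sum_ord_geN// first_dirs_all subrr; ring.
rewrite sum_ord_geS -expansion2_step opprD -IH; ring.
Qed.
End Inclusion.

(** * Symmetric second differences *)

Section SecondDifference.
Variables (R : realType) (N : nat).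
Implicit Types (f : 'rV[R]_N -> R) (z v : 'rV[R]_N).

(** The symmetric second difference of [f] with step [v]. *)
Definition second_diff v f : 'rV[R]_N -> R :=
  fun z => f (z + v) + f (z - v) - 2 * f z.

Lemma second_diffC v w f :
  second_diff v (second_diff w f) = second_diff w (second_diff v f).
Proof.
apply/funext => z; rewrite /second_diff.
rewrite !(addrAC z w) !(addrAC z (- w)); ring.
Qed.

Lemma derive_second_diff v (e : 'rV[R]_N) f :
  (forall z, derivable f z e) ->
  forall z, is_derive z e (second_diff v f) (second_diff v ('D_e f) z).
Proof.
move=> df z.
have sh w : is_derive z e (fun z => f (z + w)) ('D_e f (z + w)).
  have E : (fun h : R => h^-1 *: (((fun z => f (z + w)) \o shift z) (h *: e)
                                  - f (z + w))) =
           (fun h => h^-1 *: ((f \o shift (z + w)) (h *: e) - f (z + w))).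
    by apply/funext => h /=; rewrite addrA.
  apply: DeriveDef; first by rewrite /derivable E; exact: df.
  by rewrite /derive E.
have s0 : is_derive z e f ('D_e f z) by exact: derivableP.
have sB := is_deriveB (is_deriveD (sh v) (sh (- v))) (is_deriveZ 2 s0).
exact: is_derive_eq sB _.
Qed.

(** The second derivative need not be continuous. *)
Lemma second_diff_le1 (h dh ddh : R -> R) (M : R) :
  (forall x : R, is_derive x (1 : R) h (dh x)) ->
  (forall x : R, is_derive x (1 : R) dh (ddh x)) ->
  (forall x, `|ddh x| <= M) ->
  forall c, `|h c + h (- c) - 2 * h 0| <= c ^+ 2 * M.
Proof.
move=> hh hdh hM c.
wlog c0 : c / 0 < c.
  move=> W; have [c0|c0|<-] := ltgtP 0 c.
  - exact: W.
  - have := W (- c); rewrite oppr_gt0 opprK sqrrN (addrC (h (- c))); exact.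
  - by rewrite oppr0 expr0n/= mul0r normr_le0; apply/eqP; ring.
(* The constant K makes q vanish at c as it does at 0; the mean value theorem
   for dh on [-x, x], with x the point given by Rolle's theorem, identifies K
   with a value of ddh. *)
pose K := (h c + h (- c) - 2 * h 0) / c ^+ 2.
pose q (x : R) := (h x + h (- x)) - (2 * h 0 + K * x ^+ 2).
have hN (u du : R -> R) (x : R) :
    (forall x : R, is_derive x (1 : R) u (du x)) ->
    is_derive x (1 : R) (fun x => u (- x)) (- du (- x)).
  move=> uu.
  have := @is_derive1_comp R u -%R x (du (- x)) (-1) (uu (- x)) _.
  by rewrite mulrN1; apply; exact: is_deriveN.
have dq (x : R) : is_derive x (1 : R) q (dh x - dh (- x) - 2 * K * x).
  have -> : q = (h + (fun x => h (- x))) - (cst (2 * h 0) + K \*: (id ^+ 2)).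
    by apply/funext => y; rewrite /q /= !fctE.
  have H := is_deriveB (is_deriveD (hh x) (hN _ _ x hh))
    (is_deriveD (is_derive_cst (2 * h 0) x 1)
                (is_deriveZ K (is_deriveX 2 (is_derive_id x 1)))).
  apply: (is_derive_eq H); rewrite /GRing.scale /= expr1; ring.
have cq : continuous q.
  by move=> x; apply/differentiable_continuous/derivable1_diffP; case: (dq x).
have q0 : q 0 = q c.
  rewrite /q /K oppr0 expr0n/= mulr0 divfK ?gt_eqF ?exprn_gt0//; ring.
have [x] := Rolle c0 (fun x _ => @ex_derive _ _ _ _ _ _ _ (dq x))
  (continuous_subspaceT cq) q0.
rewrite in_itv/= => /andP[x0 xc] /@derive_val.
rewrite (@derive_val _ _ _ _ _ _ _ (dq x)) => qx0.
have xx : - x < x by lra.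
have cdh : continuous dh.
  by move=> y; apply/differentiable_continuous/derivable1_diffP; case: (hdh y).
have [y _ dhE] := MVT xx (fun y _ => hdh y) (continuous_subspaceT cdh).
have KE : K = ddh y.
  apply: (@mulfI _ (2 * x)); first by rewrite mulf_neq0// ?gt_eqF.
  have -> : 2 * x * ddh y = dh x - dh (- x) by rewrite dhE; ring.
  lra.
have -> : h c + h (- c) - 2 * h 0 = c ^+ 2 * ddh y.
  by rewrite -KE /K (mulrC (c ^+ 2)) divfK// gt_eqF// exprn_gt0.
by rewrite normrM ger0_norm ?sqr_ge0// ler_wpM2l ?sqr_ge0.
Qed.

Lemma second_diff_le (i : 'I_N) f (M : R) :
  (forall z, derivable f z (delta_mx 0 i)) ->
  (forall z, derivable (pderiv i f) z (delta_mx 0 i)) ->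
  (forall z, `|pderiv i (pderiv i f) z| <= M) ->
  forall c z, `|second_diff (c *: delta_mx 0 i) f z| <= c ^+ 2 * M.
Proof.
move=> d1 d2 bM c z; set e : 'rV[R]_N := delta_mx 0 i.
have line (u : 'rV[R]_N -> R) : (forall z, derivable u z e) -> forall x : R,
    is_derive x (1 : R) (fun s : R => u (z + s *: e)) ('D_e u (z + x *: e)).
  move=> du x.
  have E : (fun h : R => h^-1 *: (u (z + (h *: (1 : R) + x) *: e)
                                  - u (z + x *: e))) =
           (fun h => h^-1 *: ((u \o shift (z + x *: e)) (h *: e)
                              - u (z + x *: e))).
    apply/funext => h /=; congr (_ *: (u _ - _)).
    by rewrite [h *: 1]mulr1 scalerDl addrCA.
  apply: DeriveDef.
    by rewrite /derivable /= E; exact: du.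
  by rewrite /derive /= E.
have := second_diff_le1 (line _ d1) (line _ d2) (fun x => bM _) c.
by rewrite /second_diff scale0r addr0 scaleNr.
Qed.

Lemma pderiv_second_diff (i : 'I_N) v f :
  (forall z, derivable f z (delta_mx 0 i)) ->
  (forall z, derivable (second_diff v f) z (delta_mx 0 i)) /\
  pderiv i (second_diff v f) = second_diff v (pderiv i f).
Proof.
move=> df; split=> [z|]; first by case: (derive_second_diff v df z).
apply/funext => z; rewrite /pderiv.
by rewrite (@derive_val _ _ _ _ _ _ _ (derive_second_diff v df z)).
Qed.

Lemma pderiv2_second_diff (i : 'I_N) v f :
  (forall z, derivable f z (delta_mx 0 i)) ->
  (forall z, derivable (pderiv i f) z (delta_mx 0 i)) ->
  [/\ forall z, derivable (second_diff v f) z (delta_mx 0 i),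
      forall z, derivable (pderiv i (second_diff v f)) z (delta_mx 0 i) &
      pderiv i (pderiv i (second_diff v f)) =
      second_diff v (pderiv i (pderiv i f))].
Proof.
move=> d1 d2; have [s1 E1] := pderiv_second_diff v d1.
have [s2 E2] := pderiv_second_diff v d2; split; first exact: s1.
  by rewrite E1; exact: s2.
transitivity (pderiv i (second_diff v (pderiv i f))); last exact: E2.
exact: (congr1 (pderiv i) E1).
Qed.

Lemma second_diff2_le (i j : 'I_N) f (M : R) :
  pderivable [:: i; i; j; j] f ->
  (forall z, `|pderivs [:: i; i; j; j] f z| <= M) ->
  forall a b z,
  `|second_diff (a *: delta_mx 0 i) (second_diff (b *: delta_mx 0 j) f) z|
    <= b ^+ 2 * (a ^+ 2 * M).
Proof.
move=> [[[[_ j1] j2] i1] i2] fM a b z; rewrite second_diffC.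
have [uj1 uj2 ujE] := pderiv2_second_diff (a *: delta_mx 0 i) j1 j2.
refine (@second_diff_le j _ (a ^+ 2 * M) uj1 uj2 _ b z) => y.
by rewrite ujE; exact: (second_diff_le i1 i2 fM a y).
Qed.

(** The second differences commute, so that the mean value estimate can be used
    in the order in which the partial derivatives of [f] are known to exist. *)
Lemma second_diff3_le (i j k : 'I_N) f (M : R) :
  pderivable [:: i; i; j; j; k; k] f ->
  (forall z, `|pderivs [:: i; i; j; j; k; k] f z| <= M) ->
  forall a b c z,
  `|second_diff (a *: delta_mx 0 i)
      (second_diff (b *: delta_mx 0 j)
        (second_diff (c *: delta_mx 0 k) f)) z|
    <= c ^+ 2 * (b ^+ 2 * (a ^+ 2 * M)).
Proof.
move=> [[[[[[_ k1] k2] j1] j2] i1] i2] fM a b c z.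
set u := a *: _; set v := b *: _; set w := c *: _.
rewrite (second_diffC v w) (second_diffC u w).
have [vk1 vk2 vkE] := pderiv2_second_diff v k1 k2.
have [uvk1 uvk2 uvkE] := pderiv2_second_diff u vk1 vk2.
refine (@second_diff_le k _ (b ^+ 2 * (a ^+ 2 * M)) uvk1 uvk2 _ c z) => y.
rewrite uvkE vkE.
have dF : pderivable [:: i; i; j; j] (pderiv k (pderiv k f)).
  exact: (conj (conj (conj (conj I j1) j2) i1) i2).
have FM x : `|pderivs [:: i; i; j; j] (pderiv k (pderiv k f)) x| <= M.
  exact: fM x.
exact: (second_diff2_le dF FM a b y).
Qed.
End SecondDifference.

(** * Integration of weighted functions against product measures *)

Section ProductMeasure.
Local Open Scope ereal_scope.
Context (R : realType) (d : measure_display) (T : measurableType d).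

(** Tonelli's theorem for the product of a measure on [T] and one on tuples. *)
Lemma integral_cons_measure (n : nat)
    (m1 : {sigma_finite_measure set T -> \bar R})
    (m2 : {sigma_finite_measure set (n.-tuple T) -> \bar R})
    (F : n.+1.-tuple T -> \bar R) :
  measurable_fun [set: n.+1.-tuple T] F -> (forall y, 0 <= F y) ->
  \int[cons_measure m1 m2]_y F y =
  \int[m1]_x \int[m2]_v F (cons_tuple (x, v)).
Proof.
move=> mF F0.
have := @ge0_integral_pushforward _ _ _ _ _ _ (@measurable_cons_tuple d T n)
  (m1 \x m2) setT F measurableT mF (fun y _ => F0 y).
rewrite preimage_setT => pE.
transitivity (\int[m1 \x m2]_p (F \o @cons_tuple d T n) p); first exact: pE.
rewrite fubini_tonelli1//.
  exact: measurableT_comp mF (@measurable_cons_tuple d T n).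
by move=> p; exact: F0.
Qed.

Lemma measurable_prod_tnth n (w : 'I_n -> T -> R) :
  (forall k, measurable_fun [set: T] (w k)) ->
  measurable_fun [set: n.-tuple T] (fun y => \prod_k w k (tnth y k))%R.
Proof.
move=> mw; apply: measurable_prod => k _.
by apply: measurableT_comp => //; exact: measurable_tnth.
Qed.

Lemma prod_tnth_cons n (w : 'I_n.+1 -> T -> R) x (v : n.-tuple T) :
  (\prod_k w k (tnth (cons_tuple (x, v)) k) =
   w ord0 x * \prod_k w (lift ord0 k) (tnth v k))%R.
Proof.
rewrite big_ord_recl; congr (_ * _)%R.
by apply: eq_bigr => k _; rewrite tnthS.
Qed.

Lemma measurable_map_tnth n (phi : 'I_n -> T -> T) :
  (forall k, measurable_fun [set: T] (phi k)) ->
  measurable_fun [set: n.-tuple T]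
    (fun y : n.-tuple T => [tuple phi k (tnth y k) | k < n]).
Proof.
move=> mphi; apply/measurable_fun_tnthP => k.
rewrite (_ : _ \o _ = fun y : n.-tuple T => phi k (tnth y k)); last first.
  by apply/funext => y; rewrite /= tnth_mktuple.
by apply: measurableT_comp => //; exact: measurable_tnth.
Qed.

Lemma measurable_weighted n (w : 'I_n -> T -> R) (F : n.-tuple T -> \bar R) :
  (forall k, measurable_fun [set: T] (w k)) ->
  measurable_fun [set: n.-tuple T] F ->
  measurable_fun [set: n.-tuple T]
    (fun y => (\prod_k w k (tnth y k))%:E * F y).
Proof.
move=> mw mF; apply: emeasurable_funM => //.
by apply/measurable_EFinP; exact: measurable_prod_tnth.
Qed.

Lemma weighted_ge0 n (w : 'I_n -> T -> R) (F : n.-tuple T -> \bar R) y :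
  (forall k x, 0 <= w k x)%R -> (forall y, 0 <= F y) ->
  0 <= (\prod_k w k (tnth y k))%:E * F y.
Proof. by move=> w0 F0; rewrite mule_ge0// lee_fin prodr_ge0. Qed.

Lemma measurable_cons_tuple1 n x :
  measurable_fun [set: n.-tuple T] (fun v => cons_tuple (x, v)).
Proof.
exact: measurableT_comp (@measurable_cons_tuple d T n) (pair1_measurable x).
Qed.

(** A change of variables that acts on each coordinate separately, with
    densities [w k] and [w' k], may be checked coordinate by coordinate. *)
Lemma integral_prod_measure_map n
    (m m' : 'I_n -> {sigma_finite_measure set T -> \bar R})
    (w w' : 'I_n -> T -> R) (phi : 'I_n -> T -> T) :
  (forall k, measurable_fun [set: T] (w k)) ->
  (forall k, measurable_fun [set: T] (w' k)) ->
  (forall k x, 0 <= w k x)%R -> (forall k x, 0 <= w' k x)%R ->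
  (forall k, measurable_fun [set: T] (phi k)) ->
  (forall k (f : T -> \bar R), measurable_fun [set: T] f ->
     (forall x, 0 <= f x) ->
     \int[m k]_x ((w k x)%:E * f x) =
     \int[m' k]_x ((w' k x)%:E * f (phi k x))) ->
  forall F : n.-tuple T -> \bar R,
    measurable_fun [set: n.-tuple T] F -> (forall y, 0 <= F y) ->
  \int[prod_measure m]_y ((\prod_k w k (tnth y k))%:E * F y) =
  \int[prod_measure m']_y
    ((\prod_k w' k (tnth y k))%:E * F [tuple phi k (tnth y k) | k < n]).
Proof.
elim: n m m' w w' phi => [|n IH] m m' w w' phi mw mw' w0 w'0 mphi mE F mF F0.
  rewrite /= !integral_dirac ?diracT ?mul1e ?big_ord0 ?mul1e //.
  + by congr F; apply: val_inj; rewrite /= enum_ord0.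
  + apply: (measurable_weighted mw') => //.
    exact: measurableT_comp (measurable_map_tnth mphi).
  + exact: (measurable_weighted mw).
pose Phi (y : n.+1.-tuple T) := [tuple phi k (tnth y k) | k < n.+1].
have mPhi : measurable_fun setT Phi by exact: measurable_map_tnth.
pose Psi (v : n.-tuple T) := [tuple phi (lift ord0 k) (tnth v k) | k < n].
have mPsi : measurable_fun setT Psi.
  exact: (@measurable_map_tnth n (fun k => phi (lift ord0 k))).
have PhiE x v : Phi (cons_tuple (x, v)) = cons_tuple (phi ord0 x, Psi v).
  apply: eq_from_tnth => k; rewrite tnth_mktuple.
  have [j ->|->] := unliftP ord0 k; last by [].
  by rewrite !tnthS tnth_mktuple.
rewrite /= integral_cons_measure; [|exact: measurable_weighted|]; last first.
  by move=> y; exact: weighted_ge0.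
rewrite integral_cons_measure; last 2 first.
- apply: (measurable_weighted mw'); exact: measurableT_comp mF mPhi.
- by move=> y; exact: (weighted_ge0 _ w'0 (fun y => F0 (Phi y))).
pose h x v :=
  (\prod_k w' (lift ord0 k) (tnth v k))%:E * F (cons_tuple (x, Psi v)).
pose H x := \int[prod_measure (fun i => m' (lift ord0 i))]_v h x v.
have h0 x v : 0 <= h x v.
  by rewrite /h mule_ge0// lee_fin prodr_ge0.
have mh : measurable_fun [set: T * n.-tuple T] (fun p => h p.1 p.2).
  apply: emeasurable_funM.
    apply/measurable_EFinP.
    have mw'S k := mw' (lift ord0 k).
    exact: (measurableT_comp (measurable_prod_tnth mw'S)).
  have mc : measurable_fun [set: T * n.-tuple T]
      (fun p => cons_tuple (p.1, Psi p.2)).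
    apply: (measurable_cons measurable_fst).
    exact: measurableT_comp mPsi measurable_snd.
  exact: measurableT_comp mF mc.
have mh1 x : measurable_fun [set: n.-tuple T] (h x).
  exact: (measurableT_comp mh (pair1_measurable x)).
have mH : measurable_fun [set: T] H.
  exact: (measurable_fun_fubini_tonelli_F _ mh (fun p => h0 p.1 p.2)).
transitivity (\int[m ord0]_x ((w ord0 x)%:E * H x)).
  apply: eq_integral => x _; rewrite /H /h.
  have mFx : measurable_fun [set: n.-tuple T] (fun v => F (cons_tuple (x, v))).
    exact: measurableT_comp mF (measurable_cons_tuple1 x).
  have IHx := IH _ _ _ _ _
    (fun k => mw (lift ord0 k)) (fun k => mw' (lift ord0 k))
    (fun k => w0 (lift ord0 k)) (fun k => w'0 (lift ord0 k))
    (fun k => mphi (lift ord0 k)) (fun k => mE (lift ord0 k))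
    _ mFx (fun v => F0 _).
  rewrite -IHx -ge0_integralZl//; first last.
  - by rewrite lee_fin.
  - by move=> v _; rewrite mule_ge0// lee_fin prodr_ge0.
  - exact: (@measurable_weighted n (fun k => w (lift ord0 k))).
  by apply: eq_integral => v _; rewrite prod_tnth_cons EFinM muleA.
rewrite mE//; last by move=> x; exact: integral_ge0.
apply: eq_integral => x _.
rewrite /H -ge0_integralZl//; last by rewrite lee_fin.
apply: eq_integral => v _; rewrite prod_tnth_cons EFinM -muleA /h.
by rewrite -/(Phi _) PhiE.
Qed.

Lemma integral_prod_measure_le n
    (m : 'I_n -> {sigma_finite_measure set T -> \bar R})
    (w : 'I_n -> T -> R) (b : 'I_n -> R) :
  (forall k, measurable_fun [set: T] (w k)) -> (forall k x, 0 <= w k x)%R ->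
  (forall k, \int[m k]_x (w k x)%:E <= (b k)%:E) ->
  \int[prod_measure m]_y (\prod_k w k (tnth y k))%:E <= (\prod_k b k)%:E.
Proof.
elim: n m w b => [|n IH] m w b mw w0 wb.
  rewrite /= integral_dirac ?diracT ?mul1e ?big_ord0 //.
  by apply/measurable_EFinP; exact: measurable_prod_tnth.
have b0 k : (0 <= b k)%R.
  rewrite -lee_fin (le_trans _ (wb k))// integral_ge0// => x _.
  by rewrite lee_fin.
rewrite /= integral_cons_measure; last 2 first.
- by apply/measurable_EFinP; exact: measurable_prod_tnth.
- by move=> y; rewrite lee_fin prodr_ge0.
rewrite big_ord_recl EFinM.
have mr : measurable_fun [set: n.-tuple T]
    (fun v => \prod_k w (lift ord0 k) (tnth v k))%R.
  exact: (@measurable_prod_tnth n (fun k => w (lift ord0 k))).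
under eq_integral => x _.
  under eq_integral do rewrite prod_tnth_cons EFinM.
  rewrite ge0_integralZl//; last 3 first.
  - exact/measurable_EFinP.
  - by move=> v _; rewrite lee_fin prodr_ge0.
  - by rewrite lee_fin.
  over.
rewrite ge0_integralZr//; last 3 first.
- exact/measurable_EFinP.
- by move=> x _; rewrite lee_fin.
- by apply: integral_ge0 => v _; rewrite lee_fin prodr_ge0.
apply: lee_pmul => //; last first.
- exact: (IH (fun i => m (lift ord0 i)) (fun i => w (lift ord0 i))
    (fun i => b (lift ord0 i))).
- exact: wb.
- by apply: integral_ge0 => v _; rewrite lee_fin prodr_ge0.
- by apply: integral_ge0 => v _; rewrite lee_fin.
Qed.

Local Close Scope ereal_scope.

(** The change of variables for real-valued functions of any sign. No
    integrability is needed: the positive parts have equal integrals, and so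
    have the negative parts. *)
Lemma Rintegral_prod_measure_map n
    (m m' : 'I_n -> {sigma_finite_measure set T -> \bar R})
    (w w' : 'I_n -> T -> R) (phi : 'I_n -> T -> T) :
  (forall k, measurable_fun [set: T] (w k)) ->
  (forall k, measurable_fun [set: T] (w' k)) ->
  (forall k x, 0 <= w k x)%R -> (forall k x, 0 <= w' k x)%R ->
  (forall k, measurable_fun [set: T] (phi k)) ->
  (forall k (f : T -> \bar R), measurable_fun [set: T] f ->
     (forall x, 0 <= f x)%E ->
     \int[m k]_x ((w k x)%:E * f x) =
     \int[m' k]_x ((w' k x)%:E * f (phi k x)))%E ->
  forall F : n.-tuple T -> R, measurable_fun [set: n.-tuple T] F ->
  \int[prod_measure m]_y (\prod_k w k (tnth y k) * F y) =
  \int[prod_measure m']_y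
    (\prod_k w' k (tnth y k) * F [tuple phi k (tnth y k) | k < n]).
Proof.
move=> mw mw' w0 w'0 mphi mE F mF; congr fine.
have mEF : measurable_fun [set: n.-tuple T] (EFin \o F).
  exact/measurable_EFinP.
have pos (S : n.-tuple T -> R) (G : n.-tuple T -> R) : (forall y, 0 <= S y) ->
    ((fun y => (S y * G y)%:E)^\+ = fun y => (S y)%:E * (EFin \o G)^\+ y)%E.
  move=> S0; apply/funext => y; rewrite !funeposE /= -!EFin_max -EFinM.
  by rewrite maxr_pMr// mulr0.
have neg (S : n.-tuple T -> R) (G : n.-tuple T -> R) : (forall y, 0 <= S y) ->
    ((fun y => (S y * G y)%:E)^\- = fun y => (S y)%:E * (EFin \o G)^\- y)%E.
  move=> S0; apply/funext => y; rewrite !funenegE /=.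
  transitivity (maxe (- (S y * G y))%:E 0%:E) => //.
  transitivity ((S y)%:E * maxe (- G y)%:E 0%:E)%E => //.
  by rewrite -!EFin_max -EFinM maxr_pMr// mulr0 mulrN.
have P0 (u : 'I_n -> T -> R) (y : n.-tuple T) : (forall k x, 0 <= u k x) ->
    0 <= \prod_k u k (tnth y k) by move=> u0; rewrite prodr_ge0.
rewrite integralE [RHS]integralE.
rewrite (pos _ F) ?(neg _ F); try by move=> y; exact: P0.
pose F' (y : n.-tuple T) := F [tuple phi k (tnth y k) | k < n].
rewrite (pos _ F') ?(neg _ F'); try by move=> y; exact: P0.
rewrite !(integral_prod_measure_map mw mw' w0 w'0 mphi mE)//.
- by congr (_ - _)%E; apply: eq_integral => y _; rewrite ?funeposE ?funenegE.
- exact: measurable_funeneg.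
- exact: measurable_funepos.
Qed.
End ProductMeasure.

(** * Moments of the heat kernel *)

Section HeatKernel.
Context {R : realType}.
Notation mu := (@lebesgue_measure R).
Implicit Types (c x : R).

Lemma heat_kernel_ge0 c x : 0 <= heat_kernel c x.
Proof. by rewrite /heat_kernel divr_ge0 ?expR_ge0. Qed.

Lemma heat_kernelN c x : heat_kernel c (- x) = heat_kernel c x.
Proof. by rewrite /heat_kernel sqrrN. Qed.

Lemma is_derive_heat_kernel c x : c != 0 ->
  is_derive x (1 : R) (fun x => heat_kernel c x)
    (- x / (2 * c) * heat_kernel c x).
Proof.
move=> c0.
have E y : - y ^+ 2 / (4 * c) = - (4 * c)^-1 * y ^+ 2.
  by rewrite mulNr mulrC -mulNr.
have -> : (fun x => heat_kernel c x) =
    (Num.sqrt (4 * pi * c))^-1 \*: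
      (expR \o ((- (4 * c)^-1) \*: (id ^+ 2 : R -> R))).
  by apply/funext => y; rewrite /heat_kernel E mulrC.
have H := is_deriveZ (Num.sqrt (4 * pi * c))^-1
  (is_derive1_comp (is_derive_expR _)
    (is_deriveZ (- (4 * c)^-1) (is_deriveX 2 (is_derive_id x (1 : R))))).
apply: (is_derive_eq H).
rewrite /heat_kernel /GRing.scale /= /GRing.scale/= expr1.
rewrite E; set e := expR _; set s := (Num.sqrt _)^-1.
by field.
Qed.

Lemma continuous_heat_kernel c : c != 0 -> continuous (heat_kernel c).
Proof.
move=> c0 x; apply/differentiable_continuous/derivable1_diffP.
by case: (is_derive_heat_kernel x c0).
Qed.

Lemma measurable_heat_kernel c : measurable_fun setT (heat_kernel c).
Proof.
apply: measurable_funM => //; apply: measurableT_comp => //.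
by apply: measurable_funM => //; exact: measurableT_comp.
Qed.

Lemma heat_kernelE c x : 0 < c ->
  heat_kernel c x = normal_pdf 0 (Num.sqrt (2 * c)) x.
Proof.
move=> c0; rewrite normal_pdfE ?gt_eqF ?sqrtr_gt0 ?mulr_gt0//.
rewrite /heat_kernel /normal_peak /normal_fun sqr_sqrtr ?mulr_ge0 ?(ltW c0)//.
rewrite subr0 mulrC; congr (_^-1 * expR (_ / _)); last by ring.
by congr Num.sqrt; ring.
Qed.

Lemma integral_heat_kernel c : 0 < c -> (\int[mu]_x (heat_kernel c x)%:E = 1)%E.
Proof.
move=> c0; under eq_integral do rewrite heat_kernelE//.
exact: integral_normal_pdf.
Qed.

(** By evenness it is enough to integrate over the nonnegative half-line; on
    [[0, n]] this is an integration by parts, with a nonpositive boundary term. *)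
Lemma heat_kernel_second_moment c : 0 < c ->
  (\int[mu]_x (heat_kernel c x * x ^+ 2)%:E <= (2 * c)%:E)%E.
Proof.
move=> c0; have c_neq0 : c != 0 by rewrite gt_eqF.
have ck := continuous_heat_kernel c_neq0.
have cf : continuous (fun x : R => heat_kernel c x * x ^+ 2).
  by move=> x; apply: cvgM; [exact: ck|exact: exprn_continuous].
have mf : measurable_fun setT (fun x : R => heat_kernel c x * x ^+ 2).
  exact: continuous_measurable_fun.
have f0 x : 0 <= heat_kernel c x * x ^+ 2.
  by rewrite mulr_ge0 ?heat_kernel_ge0 ?sqr_ge0.
have half : (\int[mu]_(x in `[0%R, +oo[) (heat_kernel c x)%:E = (2^-1)%:E)%E.
  have := ge0_symfun_integralT (heat_kernel_ge0 c) ck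
    (fun x => esym (heat_kernelN c x)).
  rewrite integral_heat_kernel// set_itvcy => /esym.
  set I := integral _ _ _ => I2.
  have : (2^-1%:E * (2%:E * I) = 2^-1%:E * 1)%E by rewrite I2.
  by rewrite muleA -EFinM mulVf// mul1e mule1.
rewrite ge0_symfun_integralT//; last by move=> x; rewrite /= sqrrN heat_kernelN.
have -> : [set x : R | 0 <= x] = `[0%R, +oo[%classic by rewrite set_itvcy.
rewrite EFinM lee_pmul2l//.
have /cvg_lim <- // := ge0_cvgn_integral (mu := mu) f0 mf.
apply: lime_le; first by apply/cvg_ex; eexists; exact: ge0_cvgn_integral.
near=> n.
have n0 : (0 : R) < n%:R by rewrite ltr0n; near: n; exact: nbhs_infty_gt.
(* G is a primitive of x * heat_kernel c x. *)
pose G x := - (2 * c) * heat_kernel c x.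
have dG (x : R) : is_derive x (1 : R) G (x * heat_kernel c x).
  have H := is_deriveZ (- (2 * c)) (is_derive_heat_kernel x c_neq0).
  by apply: (is_derive_eq H); rewrite /GRing.scale/=; field.
have cG : continuous G.
  by move=> x; apply/differentiable_continuous/derivable1_diffP; case: (dG x).
have -> : (\int[mu]_(x in `[0%R, n%:R]) (heat_kernel c x * x ^+ 2)%:E =
   \int[mu]_(x in `[0%R, n%:R]) (x * (x * heat_kernel c x))%:E)%E.
  by apply: eq_integral => x _; congr EFin; ring.
have dLR (u du : R -> R) : (forall x : R, is_derive x (1 : R) u (du x)) ->
    derivable_oo_LRcontinuous u 0 n%:R.
  move=> uu; have cu : continuous u.
    by move=> x; apply/differentiable_continuous/derivable1_diffP; case: (uu x).
  split; first by move=> x _; case: (uu x).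
  - by apply: cvg_at_right_filter; exact: cu.
  - by apply: cvg_at_left_filter; exact: cu.
have ih : mu.-integrable `[0%R, n%:R] (EFin \o heat_kernel c).
  apply: continuous_compact_integrable; first exact: segment_compact.
  exact: continuous_subspaceT.
rewrite (@integration_by_parts _ (fun x => x) G (fun=> 1) _ 0 n%:R n0);
  last 6 first.
- by apply: continuous_subspaceT => x; exact: cvg_cst.
- by apply: (dLR _ (fun=> 1)) => x; exact: is_derive_id.
- by move=> x _; rewrite derive1E derive_id.
- by apply: continuous_subspaceT => x; apply: cvgM; [exact: cvg_id|exact: ck].
- exact: dLR dG.
- by move=> x _; rewrite derive1E (@derive_val _ _ _ _ _ _ _ (dG x)).
have -> : (\int[mu]_(x in `[0%R, n%:R]) (1 * G x)%:E =
    (- (2 * c))%:E * \int[mu]_(x in `[0%R, n%:R]) (heat_kernel c x)%:E)%E.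
  rewrite -integralZl//; apply: eq_integral => x _.
  by rewrite mul1r /G EFinM.
rewrite mul0r subr0 EFinN mulNe oppeK.
have le12 : (\int[mu]_(x in `[0%R, n%:R]) (heat_kernel c x)%:E <= 2^-1%:E)%E.
  rewrite -half; apply: ge0_subset_integral => //.
  - by apply/measurable_EFinP/measurable_funTS; exact: measurable_heat_kernel.
  - by move=> x _; rewrite lee_fin heat_kernel_ge0.
  - by apply: subset_itvl; rewrite bnd_simp.
have -> : c%:E = (0%:E + (2 * c)%:E * 2^-1%:E)%E.
  by rewrite add0e -EFinM mulrC mulrA mulVf// mul1r.
apply: leeD.
  rewrite lee_fin /G mulrA mulr_le0_ge0 ?heat_kernel_ge0//.
  by rewrite mulrN oppr_le0 mulr_ge0// mulr_ge0// ltW.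
by apply: lee_wpmul2l => //; rewrite lee_fin mulr_ge0// ltW.
Unshelve. all: by end_near. Qed.
End HeatKernel.

(** * Measurability of continuous functions of a vector *)

Section MeasurableVector.
Context (R : realType) (d : measure_display) (T : measurableType d) (N : nat).

Lemma rV_rat_ball (V : set 'rV[R]_N) (z : 'rV[R]_N) : open V -> V z ->
  exists (q : 'rV[rat]_N) (n : nat),
    ball (map_mx ratr q : 'rV[R]_N) n.+1%:R^-1 z /\
    ball (map_mx ratr q : 'rV[R]_N) n.+1%:R^-1 `<=` V.
Proof.
move=> oV Vz; have /nbhs_ballP[e /= e0 zeV] : nbhs z V by exact: open_nbhs_nbhs.
have [n ne] : exists n, n.+1%:R^-1 < e / 2.
  have [n ne] : exists n, 0 + n.+1%:R^-1 < e / 2.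
    by apply: ltr_add_invr; rewrite divr_gt0.
  by exists n; rewrite -[X in X < _]add0r.
have qP k : exists q : rat, ball (ratr q : R) n.+1%:R^-1 (z 0 k).
  have : z 0 k - n.+1%:R^-1 < z 0 k + n.+1%:R^-1.
    by rewrite ltrD2l gtrN// invr_gt0.
  move=> /rat_in_itvoo[q]; rewrite in_itv/= => qz; exists q.
  by rewrite /ball/= ltr_distl.
have [q qz] := choice qP.
have bz : ball (map_mx ratr (\row_k q k) : 'rV[R]_N) n.+1%:R^-1 z.
  by split=> [|i j]; rewrite ?invr_gt0// !mxE (ord1 i); exact: qz.
exists (\row_k q k), n; split => // w bw; apply: zeV.
apply: le_ball (ball_triangle (ball_sym bz) bw).
by rewrite (splitr e) lerD// ltW.
Qed.

(** An open set of vectors is a countable union of balls with rational centres,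
    and a ball is a product of intervals. *)
Lemma measurable_continuous_rV (g : 'rV[R]_N -> R) (psi : T -> 'rV[R]_N) :
  continuous g -> (forall k, measurable_fun [set: T] (fun y => psi y 0 k)) ->
  measurable_fun [set: T] (g \o psi).
Proof.
move=> cg mpsi; apply: (measurability _ (RGenOInfty.measurableE R)).
move=> _ [_ [r ->] <-]; rewrite setTI.
pose V := g @^-1` `]r, +oo[%classic.
have oV : open V by apply: open_comp => // z _; exact: cg.
pose B (p : 'rV[rat]_N * nat) : set 'rV[R]_N :=
  ball (map_mx ratr p.1 : 'rV[R]_N) p.2.+1%:R^-1.
have -> : (g \o psi) @^-1` `]r, +oo[ =
    \bigcup_(p in [set p | B p `<=` V]) (psi @^-1` B p).
  apply/seteqP; split => y /=.
    move=> Vy; have [q [n [qn nV]]] := rV_rat_ball oV (Vy : V (psi y)).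
    by exists (q, n).
  by move=> [p /= pV py]; exact: pV.
rewrite bigcup_mkcond; apply: countable_bigcupT_measurable => [|p].
  exact: countableP.
case: ifPn => // _.
have -> : psi @^-1` B p = \bigcap_(k in [set: 'I_N])
    (fun y => psi y 0 k) @^-1` (ball (ratr (p.1 0 k) : R) p.2.+1%:R^-1).
  apply/seteqP; split => y /=.
    by move=> [_ By] k _; have := By 0 k; rewrite mxE.
  by move=> By; split=> [|i j]; rewrite ?invr_gt0// mxE (ord1 i); exact: By.
apply: fin_bigcap_measurable => // k _.
rewrite -[X in measurable X]setTI; apply: mpsi => //.
by apply: open_measurable; exact: ball_open.
Qed.
End MeasurableVector.

(** * The solutions as means over a common probability space *)

Section HeatSolution.
Variables (R : realType) (N : nat) (lambda : 'I_N -> R) (t : R).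
Hypothesis lambda0 : forall k, 0 <= lambda k.
Hypothesis t0 : 0 < t.
Notation mR := (measurableTypeR R).
Notation mu := (@lebesgue_measure R).
Implicit Types (k : 'I_N) (nu A : {set 'I_N}) (y : N.-tuple mR) (z : 'rV[R]_N).

(** The density of the [k]-th coordinate with respect to [green_factor nu k],
    which is the Lebesgue measure in the Gaussian directions and the Dirac
    measure at [0] in the others. *)
Definition kernel_weight nu k (x : mR) : R :=
  if k \in gauss_dirs lambda nu then heat_kernel (lambda k * t) x else 1.

Definition green_factor nu k : {sigma_finite_measure set mR -> \bar R} :=
  if k \in gauss_dirs lambda nu
  then [the {sigma_finite_measure set mR -> \bar R} of mu]
  else [the {sigma_finite_measure set mR -> \bar R} of \d_(0 : mR)].

Definition heat_weight y : R :=
  \prod_k kernel_weight [set: 'I_N]%SET k (tnth y k).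

(** The mean of [F] under the product of the centred Gaussian laws of variances
    [2 * lambda k * t], the Dirac law at [0] standing for variance [0]. *)
Definition heat_mean (F : N.-tuple mR -> R) : R :=
  \int[prod_measure (green_factor [set: 'I_N]%SET)]_y (heat_weight y * F y).

(** The coordinates of [y] in [nu], the others being replaced by [0]. *)
Definition proj_coords nu y : 'rV[R]_N :=
  \row_k (if k \in nu then tnth y k else 0).

(** The reflection changing the sign of the [i]-th coordinate. *)
Definition flip_coord (i : 'I_N) y : N.-tuple mR :=
  [tuple if k == i then - tnth y k else tnth y k | k < N].

Lemma measurable_kernel_weight nu k :
  measurable_fun [set: mR] (kernel_weight nu k).
Proof.
rewrite /kernel_weight; case: (k \in _) => //; exact: measurable_heat_kernel.
Qed.

Lemma kernel_weight_ge0 nu k x : 0 <= kernel_weight nu k x.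
Proof.
by rewrite /kernel_weight; case: ifP => // _; exact: heat_kernel_ge0.
Qed.

Lemma heat_weight_ge0 y : 0 <= heat_weight y.
Proof. by apply: prodr_ge0 => k _; exact: kernel_weight_ge0. Qed.

Lemma gauss_dirs_gt0 nu k : k \in gauss_dirs lambda nu -> 0 < lambda k * t.
Proof.
by rewrite inE => /andP[_ lk]; rewrite mulr_gt0// lt_def lk lambda0.
Qed.

Lemma integral_dirac0 (f : mR -> \bar R) (h : mR -> mR) :
  measurable_fun [set: mR] f -> measurable_fun [set: mR] h ->
  (\int[\d_(0%R : mR)]_x (1%:E * f (h x)) = f (h 0%R))%E.
Proof.
move=> mf mh; under eq_integral do rewrite mul1e.
have mfh : measurable_fun [set: mR] (f \o h) by exact: measurableT_comp mf mh.
by rewrite (integral_dirac _ measurableT mfh) diracT mul1e.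
Qed.

(** In a direction outside [nu] the Dirac factor of the Green's function is
    replaced by the heat kernel, and the coordinate by the constant [0]. *)
Lemma heat_sol_mean g nu z : continuous g ->
  heat_sol lambda g nu z t = heat_mean (fun y => g (z - proj_coords nu y)).
Proof.
move=> cg; rewrite /heat_mean /heat_sol /green_measure.
under eq_Rintegral do rewrite big_mkcond/=.
pose phi k (x : mR) : mR := if k \in nu then x else 0.
have mphi k : measurable_fun [set: mR] (phi k).
  by rewrite /phi; case: (k \in nu).
have mF : measurable_fun [set: N.-tuple mR] (fun y => g (z - \row_k tnth y k)).
  apply: (measurable_continuous_rV cg) => k.
  under eq_fun do rewrite !mxE.
  by apply: measurable_funB => //; exact: measurable_tnth.
rewrite (@Rintegral_prod_measure_map _ _ _ _
   (green_factor nu) (green_factor [set: 'I_N]%SET)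
   (kernel_weight nu) (kernel_weight [set: 'I_N]%SET) phi _ _ _ _ mphi _ _ mF).
- congr fine; apply: eq_integral => y _; congr EFin.
  congr (_ * g (z - _)).
  by apply/rowP => k; rewrite !mxE tnth_mktuple.
- exact: measurable_kernel_weight.
- exact: measurable_kernel_weight.
- exact: kernel_weight_ge0.
- exact: kernel_weight_ge0.
move=> k f mf f0; rewrite /green_factor /kernel_weight.
have gE : (k \in gauss_dirs lambda nu) =
    (k \in gauss_dirs lambda [set: 'I_N]%SET) && (k \in nu).
  by rewrite !inE andbC.
rewrite gE; case: (boolP (k \in gauss_dirs lambda [set: 'I_N]%SET)) => kT /=;
  last first.
  transitivity (f 0).
    exact: (@integral_dirac0 f id mf (@measurable_id _ _ _)).
  symmetry; transitivity (f (phi k 0)).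
    exact: (integral_dirac0 mf (mphi k)).
  by rewrite /phi; case: (k \in nu).
rewrite /phi; case: (k \in nu) => //.
(* A Gaussian direction frozen to 0: the kernel integrates to 1. *)
transitivity (f 0).
  exact: (@integral_dirac0 f id mf (@measurable_id _ _ _)).
rewrite ge0_integralZr//.
- by rewrite integral_heat_kernel ?mul1e// (gauss_dirs_gt0 kT).
- by apply/measurable_EFinP; exact: measurable_heat_kernel.
- by move=> x _; rewrite lee_fin heat_kernel_ge0.
Qed.

(** The Gaussian laws are even. *)
Lemma heat_mean_flip i F : measurable_fun [set: N.-tuple mR] F ->
  heat_mean (F \o flip_coord i) = heat_mean F.
Proof.
move=> mF; rewrite /heat_mean.
pose phi k (x : mR) : mR := if k == i then - x else x.
have mphi k : measurable_fun [set: mR] (phi k).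
  by rewrite /phi; case: (k == i) => //; exact: oppr_measurable.
have mw := measurable_kernel_weight [set: 'I_N]%SET.
have w0 := kernel_weight_ge0 [set: 'I_N]%SET.
symmetry; apply: (Rintegral_prod_measure_map mw mw w0 w0 mphi) => //.
move=> k f mf f0; rewrite /green_factor /kernel_weight.
case: ifPn => kT; last first.
  transitivity (f 0).
    exact: (@integral_dirac0 f id mf (@measurable_id _ _ _)).
  symmetry; transitivity (f (phi k 0)).
    exact: (integral_dirac0 mf (mphi k)).
  by rewrite /phi; case: (k == i); rewrite ?oppr0.
rewrite /phi; case: (k == i) => //.
pose h (x : mR) := ((heat_kernel (lambda k * t) x)%:E * f x)%E.
have mh : measurable_fun [set: mR] h.
  apply: emeasurable_funM => //.
  by apply/measurable_EFinP; exact: measurable_heat_kernel.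
have h0 x : (0 <= h x)%E by rewrite mule_ge0// lee_fin heat_kernel_ge0.
transitivity (\int[pushforward mu (-%R : mR -> mR)]_x h x)%E.
  by apply: eq_measure_integral => A mA _; exact/esym/lebesgue_measureN.
have mN : measurable_fun [set: mR] (-%R : mR -> mR) by exact: oppr_measurable.
rewrite (ge0_integral_pushforward mN mu measurableT mh (fun x _ => h0 x)).
by apply: eq_integral => x _; rewrite /h /= heat_kernelN.
Qed.

Lemma integrable_heat_weight :
  (prod_measure (green_factor [set: 'I_N]%SET)).-integrable setT
    (EFin \o heat_weight).
Proof.
apply/integrableP; split.
  apply/measurable_EFinP; apply: measurable_prod_tnth => k.
  exact: measurable_kernel_weight.
under eq_integral do rewrite /= ger0_norm ?heat_weight_ge0//.
apply: (@le_lt_trans _ _ (\prod_(k < N) (1 : R))%:E); last exact: ltry.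
apply: integral_prod_measure_le => [k|k x|k].
- exact: measurable_kernel_weight.
- exact: kernel_weight_ge0.
- rewrite /kernel_weight /green_factor; case: ifPn => kT.
    by rewrite integral_heat_kernel// (gauss_dirs_gt0 kT).
  by rewrite integral_dirac// diracT mul1e.
Qed.

Definition bounded_measurable (F : N.-tuple mR -> R) : Prop :=
  measurable_fun [set: N.-tuple mR] F /\
  exists M : R, forall y, `|F y| <= M.

Lemma integrable_heat_weightM F : bounded_measurable F ->
  (prod_measure (green_factor [set: 'I_N]%SET)).-integrable setT
     (EFin \o (fun y => heat_weight y * F y)).
Proof.
move=> [mF bF].
rewrite (_ : _ \o _ = ((EFin \o heat_weight) \* (EFin \o F))%E); last first.
  by apply/funext => y /=; rewrite EFinM.
apply: integrableMl integrable_heat_weight mF _ => //.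
have [M FM] := bF; exists M; split; first exact: num_real.
by move=> x Mx y _; exact: le_trans (FM y) (ltW Mx).
Qed.

Lemma heat_meanD F G : bounded_measurable F -> bounded_measurable G ->
  heat_mean (fun y => F y + G y) = heat_mean F + heat_mean G.
Proof.
move=> /integrable_heat_weightM iF /integrable_heat_weightM iG.
rewrite /heat_mean -RintegralD//.
by apply: eq_Rintegral => y _; rewrite mulrDr.
Qed.

Lemma heat_meanB F G : bounded_measurable F -> bounded_measurable G ->
  heat_mean (fun y => F y - G y) = heat_mean F - heat_mean G.
Proof.
move=> /integrable_heat_weightM iF /integrable_heat_weightM iG.
rewrite /heat_mean -RintegralB//.
by apply: eq_Rintegral => y _; rewrite mulrBr.
Qed.

Lemma bounded_measurableD F G : bounded_measurable F -> bounded_measurable G ->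
  bounded_measurable (fun y => F y + G y).
Proof.
move=> [mF bF] [mG bG]; split; first exact: measurable_funD.
have [M FM] := bF; have [K GK] := bG; exists (M + K) => y.
exact: le_trans (ler_normD _ _) (lerD _ _).
Qed.

Lemma bounded_measurableB F G : bounded_measurable F -> bounded_measurable G ->
  bounded_measurable (fun y => F y - G y).
Proof.
move=> [mF bF] [mG bG]; split; first exact: measurable_funB.
have [M FM] := bF; have [K GK] := bG; exists (M + K) => y.
exact: le_trans (ler_normB _ _) (lerD _ _).
Qed.

(** * The triple differences of the solutions *)

Lemma measurable_flip_coord i :
  measurable_fun [set: N.-tuple mR] (flip_coord i).
Proof.
pose phi k (x : mR) : mR := if k == i then - x else x.
apply: (@measurable_map_tnth _ mR N phi) => k; rewrite /phi.
by case: (k == i) => //; exact: oppr_measurable.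
Qed.

Lemma bounded_measurable_flip i F : bounded_measurable F ->
  bounded_measurable (F \o flip_coord i).
Proof.
move=> [mF [M FM]]; split; last by exists M => y; exact: FM.
exact: measurableT_comp mF (measurable_flip_coord i).
Qed.

Lemma heat_mean_symm i F : bounded_measurable F ->
  heat_mean (fun y => F y + F (flip_coord i y)) = 2 * heat_mean F.
Proof.
move=> bF; rewrite (heat_meanD bF (bounded_measurable_flip i bF)).
by rewrite (heat_mean_flip i bF.1) mulr_natl mulr2n.
Qed.

Lemma bounded_measurable_symm i F : bounded_measurable F ->
  bounded_measurable (fun y => F y + F (flip_coord i y)).
Proof.
by move=> bF; exact: bounded_measurableD bF (bounded_measurable_flip i bF).
Qed.

Lemma bounded_measurable_proj g z nu : bounded_continuous g ->
  bounded_measurable (fun y => g (z - proj_coords nu y)).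
Proof.
move=> [cg [M [_ gM]]]; split; last first.
  by exists (M + 1) => y; apply: gM => //; rewrite ltrDl.
apply: (measurable_continuous_rV cg) => k.
under eq_fun do rewrite !mxE.
apply: measurable_funB => //; case: (k \in nu) => //; exact: measurable_tnth.
Qed.

Lemma bounded_measurable_adjoin_diff i (h : {set 'I_N} -> N.-tuple mR -> R) :
  (forall A, bounded_measurable (h A)) ->
  forall A, bounded_measurable (fun y => adjoin_diff i (h ^~ y) A).
Proof. by move=> bh A; exact: bounded_measurableB. Qed.

Lemma heat_mean_adjoin_diff i (h : {set 'I_N} -> N.-tuple mR -> R) :
  (forall A, bounded_measurable (h A)) ->
  forall A, heat_mean (fun y => adjoin_diff i (h ^~ y) A) =
    adjoin_diff i (fun B => heat_mean (h B)) A.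
Proof. by move=> bh A; exact: heat_meanB. Qed.

Lemma proj_coordsU k A y : k \notin A ->
  proj_coords (k |: A) y = proj_coords A y + tnth y k *: delta_mx 0 k.
Proof.
move=> kA; apply/rowP => l; rewrite !mxE !inE eqxx /=.
have [->|_] := eqVneq l k; first by rewrite (negbTE kA) add0r mulr1.
by rewrite mulr0 addr0.
Qed.

Lemma tnth_flip_coord k l y :
  tnth (flip_coord k y) l = if l == k then - tnth y l else tnth y l.
Proof. by rewrite tnth_mktuple. Qed.

Lemma proj_coords_flip k A y : k \notin A ->
  proj_coords A (flip_coord k y) = proj_coords A y.
Proof.
move=> kA; apply/rowP => l; rewrite !mxE tnth_flip_coord.
by have [->|//] := eqVneq l k; rewrite (negbTE kA).
Qed.

(** The two increments in direction [k], for [y] and for its reflection, add up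
    to a symmetric second difference. *)
Lemma adjoin_diff_symm (f : 'rV[R]_N -> R) z y k A : k \notin A ->
  adjoin_diff k (fun B => f (z - proj_coords B y)) A +
  adjoin_diff k (fun B => f (z - proj_coords B (flip_coord k y))) A =
  second_diff (tnth y k *: delta_mx 0 k) f (z - proj_coords A y).
Proof.
move=> kA; rewrite /adjoin_diff /second_diff !proj_coordsU// proj_coords_flip//.
rewrite tnth_flip_coord eqxx scaleNr !opprD !opprK !addrA; ring.
Qed.

(** An increment in direction [i] preserves identities between sums that hold on
    the index sets avoiding [k]. *)
Lemma adjoin_diff_add i k (P P' G : {set 'I_N} -> R) : k != i ->
  (forall A, k \notin A -> P A + P' A = G A) ->
  forall A, k \notin A ->
    adjoin_diff i P A + adjoin_diff i P' A = adjoin_diff i G A.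
Proof.
move=> ki PG A kA; rewrite /adjoin_diff -(PG A kA) -PG; first by ring.
by rewrite !inE negb_or ki.
Qed.

(** The coordinates are independent, with second moments at most
    [2 * (lambda l * t)]. *)
Lemma heat_mean_le3 (i j k : 'I_N) F (C : R) : uniq [:: i; j; k] ->
  bounded_measurable F -> 0 <= C ->
  (forall y, `|F y| <= C * (tnth y i ^+ 2 * (tnth y j ^+ 2 * tnth y k ^+ 2))) ->
  `|heat_mean F| <=
    C * (2 * (lambda i * t) * (2 * (lambda j * t) * (2 * (lambda k * t)))).
Proof.
move=> ijk bF C0 FC.
pose s := [:: i; j; k].
pose u l (x : mR) : R := if l \in s then x ^+ 2 else 1.
pose v l (x : mR) : R := kernel_weight [set: 'I_N]%SET l x * u l x.
pose b l : R := if l \in s then 2 * (lambda l * t) else 1.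
have prod3 (f : 'I_N -> R) :
    \prod_l (if l \in s then f l else 1) = f i * (f j * f k).
  by rewrite -big_mkcond -big_uniq//= !big_cons big_nil mulr1.
have mu2 l : measurable_fun [set: mR] (u l).
  by rewrite /u; case: (l \in s) => //; exact: measurable_funX.
have u0 l x : 0 <= u l x by rewrite /u; case: ifP => // _; exact: sqr_ge0.
have mv l : measurable_fun [set: mR] (v l).
  by apply: measurable_funM => //; exact: measurable_kernel_weight.
have v0 l x : 0 <= v l x by rewrite mulr_ge0// kernel_weight_ge0.
have vb l : (\int[green_factor [set: 'I_N]%SET l]_x (v l x)%:E <= (b l)%:E)%E.
  rewrite /green_factor /v /kernel_weight /u /b.
  case: (boolP (l \in gauss_dirs lambda [set: 'I_N]%SET)) => lT.
    case: (l \in s); first exact: heat_kernel_second_moment (gauss_dirs_gt0 lT).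
    under eq_integral do rewrite mulr1.
    by rewrite integral_heat_kernel// (gauss_dirs_gt0 lT).
  under eq_integral do rewrite mul1r.
  rewrite integral_dirac//; last first.
    by apply/measurable_EFinP; case: (l \in s) => //; exact: measurable_funX.
  rewrite diracT mul1e lee_fin; case: (l \in s) => //.
  by rewrite expr0n/= mulr_ge0// mulr_ge0// ltW.
have vE y : \prod_l v l (tnth y l) =
    heat_weight y * (tnth y i ^+ 2 * (tnth y j ^+ 2 * tnth y k ^+ 2)).
  by rewrite big_split/= -(prod3 (fun l => tnth y l ^+ 2)).
have mprod : measurable_fun [set: N.-tuple mR]
    (fun y => \prod_l v l (tnth y l)).
  exact: measurable_prod_tnth.
have iF := integrable_heat_weightM bF.
rewrite -lee_fin EFin_normr_Rintegral//.
apply: (le_trans (le_abse_integral _ measurableT _)).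
  by case/integrableP: iF.
have W0 := heat_weight_ge0.
apply: (@le_trans _ _ (\int[prod_measure (green_factor [set: 'I_N]%SET)]_y
    (C%:E * (\prod_l v l (tnth y l))%:E))%E).
  apply: ge0_le_integral => //.
  - apply: measurableT_comp => //; by case/integrableP: iF.
  - by apply: emeasurable_funM => //; exact/measurable_EFinP.
  - move=> y _; rewrite /= -EFinM lee_fin normrM ger0_norm// vE mulrCA.
    by rewrite ler_wpM2l.
rewrite ge0_integralZl//; last 2 first.
- exact/measurable_EFinP.
- by move=> y _; rewrite lee_fin prodr_ge0.
rewrite EFinM lee_wpmul2l//.
rewrite -(prod3 (fun l => 2 * (lambda l * t))).
exact: integral_prod_measure_le.
Qed.

Lemma adjoin_diff3_heat_sol_le (i j k : 'I_N) A g z (M : R) :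
  uniq [:: i; j; k] -> i \notin A -> j \notin A -> k \notin A ->
  bounded_continuous g ->
  pderivable [:: i; i; j; j; k; k] g ->
  (forall z, `|pderivs [:: i; i; j; j; k; k] g z| <= M) ->
  `|adjoin_diff i (adjoin_diff j (adjoin_diff k
      (fun nu => heat_sol lambda g nu z t))) A|
    <= t ^+ 3 * (lambda i * lambda j * lambda k * M).
Proof.
move=> ijk iA jA kA bg dg gM.
have M0 : 0 <= M by exact: le_trans (normr_ge0 _) (gM 0).
have [ij ik jk] : [/\ i != j, i != k & j != k].
  by move: ijk; rewrite /= !inE negb_or andbT => /andP[/andP[]].
pose h B y := g (z - proj_coords B y).
have bh B : bounded_measurable (h B) by exact: bounded_measurable_proj.
pose Q y := adjoin_diff i (adjoin_diff j (adjoin_diff k (h ^~ y))) A.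
have bk := bounded_measurable_adjoin_diff k bh.
have bj := bounded_measurable_adjoin_diff j bk.
have bQ : bounded_measurable Q.
  exact: (bounded_measurable_adjoin_diff i bj A).
have -> : adjoin_diff i (adjoin_diff j (adjoin_diff k
    (fun nu => heat_sol lambda g nu z t))) A = heat_mean Q.
  rewrite (heat_mean_adjoin_diff i bj).
  rewrite (_ : (fun B => heat_mean _) =
    adjoin_diff j (adjoin_diff k (fun nu => heat_sol lambda g nu z t)))//.
  apply/funext => B; rewrite (heat_mean_adjoin_diff j bk).
  congr (adjoin_diff j _ B); apply/funext => B'.
  rewrite (heat_mean_adjoin_diff k bh).
  congr (adjoin_diff k _ B'); apply/funext => nu.
  by rewrite heat_sol_mean//; exact: bg.1.
(* Adding to Q its reflections in the directions k, j and i multiplies its mean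
   by 8. *)
pose S1 y := Q y + Q (flip_coord k y).
pose S2 y := S1 y + S1 (flip_coord j y).
pose S3 y := S2 y + S2 (flip_coord i y).
have b1 : bounded_measurable S1 by exact: bounded_measurable_symm.
have b2 : bounded_measurable S2 by exact: bounded_measurable_symm.
have b3 : bounded_measurable S3 by exact: bounded_measurable_symm.
have S3Q : heat_mean S3 = 8 * heat_mean Q.
  by rewrite !heat_mean_symm// !mulrA -!natrM.
pose e l : 'rV[R]_N := delta_mx 0 l.
have S1E y : S1 y = adjoin_diff i (adjoin_diff j (fun B =>
    second_diff (tnth y k *: e k) g (z - proj_coords B y))) A.
  apply: (adjoin_diff_add (k := k)) kA; first by rewrite eq_sym.
  apply: adjoin_diff_add; first by rewrite eq_sym.
  by move=> B kB; exact: adjoin_diff_symm.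
have S2E y : S2 y = adjoin_diff i (fun B =>
    second_diff (tnth y j *: e j) (second_diff (tnth y k *: e k) g)
      (z - proj_coords B y)) A.
  rewrite /S2 !S1E tnth_flip_coord eq_sym (negbTE jk).
  apply: (adjoin_diff_add (k := j)) jA; first by rewrite eq_sym.
  by move=> B jB; exact: adjoin_diff_symm.
have S3E y : S3 y =
    second_diff (tnth y i *: e i) (second_diff (tnth y j *: e j)
      (second_diff (tnth y k *: e k) g)) (z - proj_coords A y).
  rewrite /S3 !S2E !tnth_flip_coord.
  rewrite (eq_sym j) (eq_sym k) (negbTE ij) (negbTE ik).
  exact: adjoin_diff_symm.
have S3M y : `|S3 y| <= M * (tnth y i ^+ 2 * (tnth y j ^+ 2 * tnth y k ^+ 2)).
  rewrite S3E; apply: le_trans (second_diff3_le dg gM _ _ _ _) _.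
  by rewrite le_eqVlt; apply/orP; left; apply/eqP; ring.
have := heat_mean_le3 ijk b3 M0 S3M.
rewrite S3Q normrM ger0_norm// => S3le.
rewrite -(@ler_pM2l _ 8)//; apply: (le_trans S3le).
by rewrite le_eqVlt; apply/orP; left; apply/eqP; ring.
Qed.
End HeatSolution.

(** * The error bound *)

Lemma supnorm_fin_num (R : realType) (N : nat) (f : 'rV[R]_N -> R) :
  bounded_fun f -> supnorm f \is a fin_num.
Proof.
move=> [M [_ fM]]; rewrite ge0_fin_numE.
  apply: (@le_lt_trans _ _ (M + 1)%:E); last exact: ltry.
  by apply: ge_ereal_sup => _ [z _ <-]; rewrite lee_fin fM// ltrDl.
apply: le_trans (ereal_sup_ubound _); last by exists 0.
by rewrite lee_fin.
Qed.

Lemma le_supnorm (R : realType) (N : nat) (f : 'rV[R]_N -> R) z :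
  (`|f z|%:E <= supnorm f)%E.
Proof. by apply: ereal_sup_ubound; exists z. Qed.

Theorem theorem14 (R : realType) (N r : nat) (lambda : 'I_N -> R)
    (g : 'rV[R]_N -> R) (T : R) :
  (1 <= N)%N -> (r <= N)%N ->
  (forall i j : 'I_N, (i <= j)%N -> lambda j <= lambda i) ->
  (forall i : 'I_N, 0 <= lambda i) ->
  C_mix 2 3 g ->
  forall t : R, 0 < t < T ->
  (supnorm (fun z => expansion_error r lambda g z t) <=
   (t ^+ 3)%:E *
   \sum_(i < N | (r <= i)%N) \sum_(j < N | (i < j)%N) \sum_(k < N | (j < k)%N)
     (lambda i * lambda j * lambda k)%:E *
     supnorm (pderivs [:: i; i; j; j; k; k] g))%E.
Proof.
move=> _ rN _ lambda0 [bg dg] t /andP[t0 _].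
pose D (i j k : 'I_N) := pderivs [:: i; i; j; j; k; k] g.
pose M i j k : R := fine (supnorm (D i j k)).
have dgP (i j k : 'I_N) : (i < j)%N -> (j < k)%N ->
    pderivable [:: i; i; j; j; k; k] g /\ bounded_fun (D i j k).
  move=> ij jk.
  have [|pd [_ bd]] := dg [:: i; j; k] erefl; first by rewrite /= ij jk.
  by split.
have ME (i j k : 'I_N) : (i < j)%N -> (j < k)%N ->
    supnorm (D i j k) = (M i j k)%:E.
  by move=> ij jk; rewrite fineK// supnorm_fin_num//; case: (dgP _ _ _ ij jk).
have -> : (\sum_(i < N | (r <= i)%N) \sum_(j < N | (i < j)%N)
      \sum_(k < N | (j < k)%N) (lambda i * lambda j * lambda k)%:E *
      supnorm (pderivs [:: i; i; j; j; k; k] g))%E =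
    (\sum_(i < N | (r <= i)%N) \sum_(j < N | (i < j)%N)
      \sum_(k < N | (j < k)%N) lambda i * lambda j * lambda k * M i j k)%:E.
  rewrite -sumEFin; apply: eq_bigr => i _; rewrite -sumEFin.
  apply: eq_bigr => j ij; rewrite -sumEFin; apply: eq_bigr => k jk.
  by rewrite -/(D i j k) ME// -EFinM.
rewrite -EFinM; apply: ge_ereal_sup => _ [z _ <-]; rewrite lee_fin.
pose H nu := heat_sol lambda g nu z t.
rewrite (_ : expansion_error r lambda g z t =
  expansion2 r H - H [set: 'I_N]%SET)// expansion2E// normrN.
rewrite mulr_sumr; apply: le_trans (ler_norm_sum _ _ _) (ler_sum _ _) => i _.
rewrite mulr_sumr; apply: le_trans (ler_norm_sum _ _ _) (ler_sum _ _) => j ij.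
rewrite mulr_sumr; apply: le_trans (ler_norm_sum _ _ _) (ler_sum _ _) => k jk.
have [dD bD] := dgP _ _ _ ij jk.
apply: adjoin_diff3_heat_sol_le => //.
- rewrite /= !inE negb_or andbT -!val_eqE/= !ltn_eqF//.
  exact: ltn_trans jk.
- by rewrite inE ltnn.
- by rewrite inE -leqNgt ltnW.
- by rewrite inE -leqNgt ltnW// (ltn_trans ij).
- by move=> w; rewrite -lee_fin -ME//; exact: le_supnorm.
Qed.
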